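(* For $n<\omega$ let $K_n$ be the complete graph on $n$ vertices. Then: (1) if $n\geq 3$, then $\Gamma(K_n)$ is not isomorphic to $\widetilde{\Gamma(K_n)}$; (2) if $n\geq 1$, then $\Gamma(K_{2n+1})$ and $\widetilde{\Gamma(K_{2n+1})}$ cannot be distinguished by the $n$-dimensional Weisfeiler–Leman algorithm; (3) if $n\geq 4$, then $\forall$ has a winning strategy in the Seurat game $\mathbf{G}^2(\Gamma(K_n),\widetilde{\Gamma(K_n)})$.
   Context: Graphs here are finite and undirected (an undirected edge counts as an edge in both directions). Let $G$ be an irreflexive undirected graph in which every vertex has degree at least one, with edge set $E(G)$. For a vertex $v$, the gadget $X_v$ has internal vertices $i(v,S)$, one for each subset $S$ of the set of edges of $G$ incident to $v$ (written as pairs $(v,w)$) with $|S|$ even, and external vertices $a(v,w),b(v,w)$ for each edge $(v,w)\in E(G)$; its edges are $\{i(v,S),a(v,w)\}$ for $(v,w)\in S$ and $\{i(v,S),b(v,w)\}$ for $(v,w)\in E(G)\setminus S$. The graph $\Gamma(G)$ is the disjoint union of all gadgets $X_v$ ($v\in G$) together with the edges $\{a(v,w),a(w,v)\}$ and $\{b(v,w),b(w,v)\}$ for every edge $(v,w)$ of $G$. The graph $\widetilde{\Gamma(G)}$ is obtained from $\Gamma(G)$ by choosing an (arbitrary) edge $(v,w)$ of $G$ and replacing the two edges $\{a(v,w),a(w,v)\},\{b(v,w),b(w,v)\}$ by $\{a(v,w),b(w,v)\},\{b(v,w),a(w,v)\}$; the claims hold for any choice of this edge. Two graphs are distinguished by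 the $k$-dimensional Weisfeiler–Leman algorithm iff there is a sentence of the counting logic $\mathsf{C}^{k+1}$ (first-order logic in the edge relation extended by counting quantifiers $\exists^{\geq i}$, using at most $k+1$ variable symbols) true in one and false in the other. Seurat game $\mathbf{G}^k(G,H)$: two players $\forall,\exists$, a set $\mathbf{Col}$ of $k$ colours. A position is a pair of functions $g:\mathbf{Col}\to\wp(G)$, $h:\mathbf{Col}\to\wp(H)$, initially all empty. In each of $\omega$ rounds $\forall$ chooses a colour $c$, one of the graphs and a subset of its vertices; $\exists$ then chooses a subset of the other graph; $c$ is then assigned these two sets (erasing its previous use). The palette of a vertex is the set of colours whose set contains it; $P^G$ is the set of vertices of $G$ with palette exactly $P$. $\forall$ wins in round $n$ if at its beginning (C1) some palette $P$ has $P^G$ empty and $P^H$ nonempty or vice versa, or (C2) there are palettes $P_1,P_2$ with an edge from $P_1^G$ to $P_2^G$ but none from $P_1^H$ to $P_2^H$, or vice versa. $\forall$ has a winning strategy if he can guarantee a win in finitely many rounds. *)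

(* Defs.v *)
From HB Require Import structures.
From mathcomp Require Import all_boot.

Set Implicit Arguments.
Unset Strict Implicit.
Unset Printing Implicit Defensive.

Record ugraph := UGraph {
  vertex :> finType;
  adj : rel vertex;
  adj_sym : symmetric adj
}.

Definition isomorphic (G H : ugraph) : Prop :=
  exists2 f : G -> H, bijective f & forall x y, adj (f x) (f y) = adj x y.

Definition neq_rel (n : nat) : rel 'I_n := fun i j => i != j.

Lemma neq_rel_sym n : symmetric (@neq_rel n).
Proof. by move=> i j; rewrite /neq_rel eq_sym. Qed.

Definition complete_graph (n : nat) : ugraph := UGraph (@neq_rel_sym n).

Section Gamma.
Variable G : ugraph.

(* Edges as ordered pairs: an edge between v and w yields both (v, w), which  *)
(* is regarded as incident to v, and (w, v), regarded as incident to w.       *)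
Definition arc : finType := {p : G * G | adj p.1 p.2}.

Definition incident (v : G) : {set G * G} :=
  [set p : G * G | (p.1 == v) && adj p.1 p.2].

Definition internal : finType :=
  {vS : G * {set G * G} | (vS.2 \subset incident vS.1) && ~~ odd #|vS.2|}.

Definition swap (p : G * G) : G * G := (p.2, p.1).

Lemma swapK : involutive swap.
Proof. by case. Qed.

Lemma eq_swap p q : (q == swap p) = (p == swap q).
Proof. by rewrite -(inv_eq swapK) eq_sym. Qed.

Definition gamma_vertex : finType := (internal + (arc + arc))%type.
End Gamma.

Notation vint i := (inl i) (only parsing).
Notation vexta p := (inr (inl p)) (only parsing).
Notation vextb p := (inr (inr p)) (only parsing).

Section GammaEdges.
Variable G : ugraph.
Implicit Types x y : gamma_vertex G.

(* One orientation of the edges {i(v,S), a(v,w)} and {i(v,S), b(v,w)} of the  *)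
(* gadgets X_v.                                                               *)
Definition gadget_arc x y : bool :=
  match x, y with
  | vint i, vexta p => val p \in (val i).2
  | vint i, vextb p => ((val p).1 == (val i).1) && (val p \notin (val i).2)
  | _, _ => false
  end.

Definition gadget_adj x y : bool := gadget_arc x y || gadget_arc y x.

(* The edges {a(v,w), a(w,v)} and {b(v,w), b(w,v)}, for the pairs (v,w)       *)
(* satisfying D.                                                              *)
Definition straight_adj (D : pred (G * G)) x y : bool :=
  match x, y with
  | vexta p, vexta q | vextb p, vextb q =>
      (val q == swap (val p)) && D (val p)
  | _, _ => false
  end.

(* The edges {a(v,w), b(w,v)}, for the pairs (v,w) satisfying D.              *)
Definition crossed_adj (D : pred (G * G)) x y : bool :=
  match x, y with
  | vexta p, vextb q | vextb p, vexta q =>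
      (val q == swap (val p)) && D (val p)
  | _, _ => false
  end.

Definition edge_is (v w : G) : pred (G * G) :=
  fun p => (p == (v, w)) || (p == (w, v)).

Definition gamma_adj x y : bool := gadget_adj x y || straight_adj predT x y.

Definition gamma_tilde_adj (v w : G) x y : bool :=
  [|| gadget_adj x y, straight_adj (predC (edge_is v w)) x y
    | crossed_adj (edge_is v w) x y].

Lemma gadget_adj_sym : symmetric gadget_adj.
Proof. by move=> x y; rewrite /gadget_adj orbC. Qed.

Lemma edge_is_swap v w p : edge_is v w (swap p) = edge_is v w p.
Proof. by case: p => a b; rewrite /edge_is /swap /= !xpair_eqE orbC; congr orb; rewrite andbC. Qed.

Lemma link_sym (D : pred (G * G)) (p q : G * G) :
  (forall r, D (swap r) = D r) ->
  (q == swap p) && D p = (p == swap q) && D q.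
Proof.
move=> DS; rewrite eq_swap; case: (p =P swap q) => //= ->.
by rewrite DS.
Qed.

Lemma straight_adj_sym (D : pred (G * G)) :
  (forall r, D (swap r) = D r) -> symmetric (straight_adj D).
Proof. by move=> DS [i|[p|p]] [j|[q|q]] //=; apply: link_sym. Qed.

Lemma crossed_adj_sym (D : pred (G * G)) :
  (forall r, D (swap r) = D r) -> symmetric (crossed_adj D).
Proof. by move=> DS [i|[p|p]] [j|[q|q]] //=; apply: link_sym. Qed.

Lemma gamma_adj_sym : symmetric gamma_adj.
Proof.
by move=> x y; rewrite /gamma_adj gadget_adj_sym straight_adj_sym.
Qed.

Lemma gamma_tilde_adj_sym v w : symmetric (gamma_tilde_adj v w).
Proof.
move=> x y; rewrite /gamma_tilde_adj gadget_adj_sym straight_adj_sym.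
  by rewrite crossed_adj_sym // => r; apply: edge_is_swap.
by move=> r; rewrite /= edge_is_swap.
Qed.
End GammaEdges.

Definition Gamma (G : ugraph) : ugraph := UGraph (@gamma_adj_sym G).

(* The edge (v, w) is the one whose two links are crossed; this is meant for  *)
(* v and w adjacent.                                                          *)
Definition GammaTilde (G : ugraph) (v w : G) : ugraph :=
  UGraph (@gamma_tilde_adj_sym G v w).

(* m is the number of available variable symbols; CExists i x phi is          *)
(* "at least i vertices x satisfy phi"; equality is a logical symbol.          *)
Inductive cformula (m : nat) : Type :=
  | CEq (x y : 'I_m)
  | CAdj (x y : 'I_m)
  | CNot (phi : cformula m)
  | CAnd (phi psi : cformula m)
  | COr (phi psi : cformula m)
  | CExists (i : nat) (x : 'I_m) (phi : cformula m).

Arguments CEq {m}.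
Arguments CAdj {m}.

Fixpoint free_vars m (phi : cformula m) : {set 'I_m} :=
  match phi with
  | CEq x y | CAdj x y => [set x; y]
  | CNot phi => free_vars phi
  | CAnd phi psi | COr phi psi => free_vars phi :|: free_vars psi
  | CExists _ x phi => free_vars phi :\ x
  end.

Definition sentence m (phi : cformula m) : bool := free_vars phi == set0.

Fixpoint csat m (G : ugraph) (s : 'I_m -> G) (phi : cformula m) : bool :=
  match phi with
  | CEq x y => s x == s y
  | CAdj x y => adj (s x) (s y)
  | CNot phi => ~~ csat s phi
  | CAnd phi psi => csat s phi && csat s psi
  | COr phi psi => csat s phi || csat s psi
  | CExists i x phi =>
      i <= #|[set u : G | csat (fun y => if y == x then u else s y) phi]|
  end.

Definition ctrue m (G : ugraph) (phi : cformula m) : Prop :=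
  forall s : 'I_m -> G, csat s phi.

(* Distinguishability by the k-dimensional Weisfeiler-Leman algorithm, in     *)
(* terms of the counting logic C^(k+1).                                       *)
Definition WL_distinguished (k : nat) (G H : ugraph) : Prop :=
  exists2 phi : cformula k.+1, sentence phi &
    (ctrue G phi /\ ~ ctrue H phi) \/ (~ ctrue G phi /\ ctrue H phi).

Section Seurat.
Variables (k : nat) (G H : ugraph).

Definition colouring (K : ugraph) : Type := {ffun 'I_k -> {set K}}.
Definition position : Type := (colouring G * colouring H)%type.

Definition start : position := ([ffun=> set0], [ffun=> set0]).

Definition palette (K : ugraph) (g : colouring K) (u : K) : {set 'I_k} :=
  [set c | u \in g c].

Definition palette_class (K : ugraph) (g : colouring K) (P : {set 'I_k}) :
  {set K} := [set u | palette g u == P].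

Definition palette_adj (K : ugraph) (g : colouring K) (P1 P2 : {set 'I_k}) :
  bool :=
  [exists x in palette_class g P1, exists y in palette_class g P2, adj x y].

Definition forall_wins_at (p : position) : Prop :=
  (exists P, (palette_class p.1 P == set0) != (palette_class p.2 P == set0))
  \/ (exists P1 P2, palette_adj p.1 P1 P2 != palette_adj p.2 P1 P2).

(* A colour together with a set of vertices of one of the two graphs.         *)
Definition move : Type := ('I_k * ({set G} + {set H}))%type.

Definition paint (K : ugraph) (g : colouring K) (c : 'I_k) (A : {set K}) :
  colouring K := [ffun d => if d == c then A else g d].

Definition next_position (p : position) (m : move) (q : position) : Prop :=
  match m.2 with
  | inl A => exists B, q = (paint p.1 m.1 A, paint p.2 m.1 B)
  | inr B => exists A, q = (paint p.1 m.1 A, paint p.2 m.1 B)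
  end.

(* A strategy for the first player may depend on all positions so far.        *)
Definition strategy : Type := seq position -> move.

Definition play_of (sigma : strategy) (p : nat -> position) : Prop :=
  p 0 = start /\
  forall r, next_position (p r) (sigma (mkseq p r.+1)) (p r.+1).

Definition seurat_forall_wins : Prop :=
  exists sigma : strategy, forall p : nat -> position,
    play_of sigma p -> exists r, forall_wins_at (p r).
End Seurat.

(* Main.v *)
(* (1) Homomorphisms from Gamma to GammaTilde lying over the same map of      *)
(* fibres can be added, with values in Gamma, as twists cancel.  Adding a     *)
(* reference homomorphism injects Hom(Gamma, GammaTilde) into                 *)
(* Hom(Gamma, Gamma), missing the identity: a homomorphism over the identity  *)
(* would select even sets of arcs with exactly one unbalanced edge.           *)
(* (2) Translating a gadget X_u by two arcs (u, q), (u, u') moves the twist   *)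
(* from the edge uq to uu', so it can be kept next to a gadget that contains  *)
(* the value of no variable.                                                  *)
(* (3) In Gamma the vertices i(v, {}) form a set of n vertices any two of     *)
(* which are at distance 3.  For n >= 4 such a set selects an internal vertex *)
(* in each gadget, so by the parity argument of (1) GammaTilde has none, and  *)
(* its existence can be tested with two set variables.                        *)

From mathcomp Require Import all_boot.
Require Import Defs.

Set Implicit Arguments.
Unset Strict Implicit.
Unset Printing Implicit Defensive.

(** * Symmetric differences and parity *)

Section SymmetricDifference.
Variable T : finType.
Implicit Types A B : {set T}.

Definition setsd A B : {set T} := [set x | (x \in A) (+) (x \in B)].

Lemma in_setsd A B x : (x \in setsd A B) = (x \in A) (+) (x \in B).
Proof. by rewrite inE. Qed.

Lemma odd_card A : odd #|A| = \big[addb/false]_x (x \in A).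
Proof.
rewrite -sum1_card (big_morph odd oddD erefl) big_mkcond.
by apply: eq_bigr => x _; case: (x \in A).
Qed.

Lemma odd_card_setsd A B : odd #|setsd A B| = odd #|A| (+) odd #|B|.
Proof.
by rewrite !odd_card -big_split; apply: eq_bigr => x _; rewrite in_setsd.
Qed.
End SymmetricDifference.

Section Parity.
Variable G : ugraph.
Hypothesis irrG : irreflexive (@adj G).

Lemma edge_is_addb (v w : G) p : v != w ->
  edge_is v w p = (p == (v, w)) (+) (swap p == (v, w)).
Proof.
move=> vw; rewrite /edge_is [swap p == _](inv_eq (@swapK G)).
by case: (p =P (v, w)) => [->|] //=; rewrite xpair_eqE (negPf vw).
Qed.

(* Each even set contributes an even number of arcs, whereas the arcs of a    *)
(* pair {(x, y), (y, x)} are both in or both out, save for one pair.          *)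
Lemma no_even_section (v w : G) (S : G -> {set G * G}) : adj v w ->
  (forall u, S u \subset incident u) -> (forall u, ~~ odd #|S u|) ->
  ~ (forall p, adj p.1 p.2 ->
       (p \in S p.1) (+) (swap p \in S p.2) = edge_is v w p).
Proof.
move=> vw Sinc Seven SE.
have nvw : v != w by apply: contraTneq vw => ->; rewrite irrG.
have mem_adj p u : p \in S u -> (p.1 == u) && adj p.1 p.2.
  by move=> /(subsetP (Sinc u)); rewrite inE.
pose T := [set p : G * G | p \in S p.1].
have even_T : ~~ odd #|T|.
  rewrite odd_card (partition_big fst predT) //= big1 // => u _.
  transitivity (odd #|S u|); last exact: negbTE.
  rewrite odd_card big_mkcond; apply: eq_bigr => p _.
  case: eqP => [<-|pu]; first by rewrite inE.
  by apply/esym/negbTE; apply/negP => /mem_adj /andP[/eqP].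
(* Orienting each edge by the ranks of its ends makes it occur once; the backward arcs are then
   folded onto the forward ones by [swap]. *)
pose before (p : G * G) := enum_rank p.1 < enum_rank p.2.
case/negP: even_T; rewrite odd_card (bigID before) /=.
have -> : \big[addb/false]_(p | ~~ before p) (p \in T) =
          \big[addb/false]_(p | before p) (swap p \in T).
  rewrite [RHS](reindex_inj (can_inj (@swapK G))) [LHS]big_mkcond.
  rewrite [RHS]big_mkcond; apply: eq_bigr => p _; rewrite swapK /before /=.
  case: ltngtP => //= /ord_inj /enum_rank_inj pE; apply: negbTE.
  by rewrite inE; apply/negP => /mem_adj; rewrite pE irrG andbF.
rewrite -big_split /=.
have edgeE p : (p \in T) (+) (swap p \in T) = edge_is v w p.
  rewrite !inE; case: (boolP (adj p.1 p.2)) => [/SE //|nadj].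
  have [-> ->] : (p \in S p.1) = false /\ (swap p \in S p.2) = false.
    split; apply/negbTE/negP => /mem_adj; rewrite ?(negPf nadj) ?andbF //.
    by rewrite adj_sym (negPf nadj) andbF.
  apply/esym/negbTE; apply: contra nadj; rewrite /edge_is.
  by case/orP=> /eqP-> //=; rewrite adj_sym.
under eq_bigr => p _ do rewrite edgeE.
pose e := if before (v, w) then (v, w) else (w, v).
rewrite (bigD1 e) /=; last first.
  rewrite /e; case: ifP => //; rewrite /before /=.
  case: ltngtP => // /ord_inj /enum_rank_inj vwE.
  by rewrite vwE eqxx in nvw.
rewrite big1 => [|p /andP[bp pe]].
  by rewrite addbF /edge_is /e; case: ifP; rewrite eqxx ?orbT.
apply/negbTE; apply: contra pe; rewrite /edge_is /e.
case/orP=> /eqP pE; move: bp; rewrite pE => bp; first by rewrite bp.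
by move: bp; rewrite /before /=; case: ltngtP.
Qed.
End Parity.

(** * Gadgets with arbitrary crossed edges, and their translations *)

Section Gadgets.
Variable G : ugraph.
Implicit Types (x y : gamma_vertex G) (D : pred (G * G)) (T : {set G * G}).
Implicit Types (p q : arc G) (i j : internal G).

(** A common frame for both graphs: [D] is [pred0] for Gamma and [edge_is v w] for GammaTilde. *)
Definition twisted_adj D x y : bool :=
  [|| gadget_adj x y, straight_adj (predC D) x y | crossed_adj D x y].

Lemma gamma_adjE : @gamma_adj G =2 twisted_adj pred0.
Proof.
move=> x y; rewrite /gamma_adj /twisted_adj; congr (_ || _).
by case: x y => [i|[p|p]] [j|[q|q]] //=; rewrite ?andbF ?orbF.
Qed.

Definition ext (b : bool) p : gamma_vertex G := if b then vexta p else vextb p.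

Variant gamma_vertex_spec : gamma_vertex G -> Type :=
  | GammaInt i : gamma_vertex_spec (inl i)
  | GammaExt b p : gamma_vertex_spec (ext b p).

Lemma gammaP x : gamma_vertex_spec x.
Proof.
case: x => [i|[p|p]]; [exact: GammaInt | exact: (GammaExt true) |].
exact: (GammaExt false).
Qed.

Lemma twisted_int_int D i j : twisted_adj D (inl i) (inl j) = false.
Proof. by []. Qed.

Lemma twisted_int_ext D i b p : twisted_adj D (inl i) (ext b p) =
  ((val p).1 == (val i).1) && ((val p \in (val i).2) == b).
Proof.
case: b; rewrite /twisted_adj /gadget_adj /= !orbF ?eqb_id ?eqbF_neg //.
apply/idP/andP => [pS|[]//]; split=> //.
by case/andP: (valP i) => /subsetP/(_ _ pS); rewrite inE => /andP[].
Qed.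

Lemma twisted_extC D i b p :
  twisted_adj D (ext b p) (inl i) = twisted_adj D (inl i) (ext b p).
Proof. by rewrite /twisted_adj gadget_adj_sym; case: b. Qed.

Lemma twisted_ext_ext D b p c q : twisted_adj D (ext b p) (ext c q) =
  (val q == swap (val p)) && (b (+) c == D (val p)).
Proof.
rewrite /twisted_adj; case: b c => [] [] /=; rewrite ?orbF;
by case: (D _).
Qed.

Definition gadget x : G :=
  match x with
  | vint i => (val i).1
  | vexta p | vextb p => (val p).1
  end.

Lemma gadget_ext b p : gadget (ext b p) = (val p).1.
Proof. by case: b. Qed.

Lemma empty_int_subproof (u : G) :
  ((u, set0).2 \subset incident u) && ~~ odd #|(u, @set0 (G * G)%type).2|.
Proof. by rewrite sub0set cards0. Qed.

Definition empty_int (u : G) : internal G := Sub (u, set0) (empty_int_subproof u).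

Lemma ext_inj b p c q : ext b p = ext c q -> b = c /\ p = q.
Proof. by case: b c => [] [] // [->]. Qed.

(* The default branch of insubd is taken when T meets the gadget oddly.       *)
Definition translate T x : gamma_vertex G :=
  match x with
  | vint i =>
      inl (insubd i ((val i).1, setsd (val i).2 (T :&: incident (val i).1)))
  | vexta p => ext (val p \notin T) p
  | vextb p => ext (val p \in T) p
  end.

Lemma translate_ext T b p : translate T (ext b p) = ext (b (+) (val p \in T)) p.
Proof. by case: b => //=; rewrite ?addTb. Qed.

Lemma val_translate_int T i : ~~ odd #|T :&: incident (val i).1| ->
  val (insubd i ((val i).1, setsd (val i).2 (T :&: incident (val i).1))) =
  ((val i).1, setsd (val i).2 (T :&: incident (val i).1)).
Proof.
move=> evT; apply: insubdK; case/andP: (valP i) => /subsetP iinc iev.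
rewrite -topredE /= odd_card_setsd (negPf evT) (negPf iev) andbT.
apply/subsetP => p; rewrite in_setsd inE; case: (boolP (p \in _)) => [/iinc|_] //.
by rewrite addFb => /andP[].
Qed.

Lemma translate_eq T T' x :
  (forall p : G * G, p.1 = gadget x -> (p \in T) = (p \in T')) ->
  translate T x = translate T' x.
Proof.
case: (gammaP x) => [i|b p] TT' /=; last first.
  by rewrite !translate_ext TT' // gadget_ext.
congr (inl (insubd _ (_, setsd _ _))); apply/setP => p.
by rewrite !in_setI !inE; case: eqP => [/TT' ->|_]; rewrite ?andbF.
Qed.

Lemma translate0 x : translate set0 x = x.
Proof.
case: (gammaP x) => [i|b p]; last by rewrite translate_ext in_set0 addbF.
congr inl; apply: val_inj; rewrite val_translate_int ?set0I ?cards0 //.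
rewrite [RHS]surjective_pairing; congr (_, _); apply/setP => p.
by rewrite in_setsd in_set0 addbF.
Qed.

Section EvenTranslation.
Variable T : {set G * G}.
Hypothesis evT : forall u, ~~ odd #|T :&: incident u|.

Lemma gadget_translate x : gadget (translate T x) = gadget x.
Proof.
case: (gammaP x) => [i|b p] /=; last by rewrite translate_ext !gadget_ext.
by rewrite val_translate_int.
Qed.

Lemma translateK : involutive (translate T).
Proof.
move=> x; case: (gammaP x) => [i|b p]; last by rewrite !translate_ext addbK.
congr inl; apply: val_inj; rewrite /= val_translate_int val_translate_int //=.
rewrite [RHS]surjective_pairing; congr (_, _); apply/setP => p.
by rewrite !in_setsd addbK.
Qed.

(** Inside a gadget both ends of an edge shift by the same bit, so adjacency persists. A link
    changes between straight and crossed exactly when [T] contains one of its two arcs but not the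
    other. *)
Lemma translate_adj D D' x y :
  (forall p : G * G, adj p.1 p.2 -> D' p = D p (+) (p \in T) (+) (swap p \in T)) ->
  twisted_adj D' (translate T x) (translate T y) = twisted_adj D x y.
Proof.
move=> DD'.
have intext i b p : twisted_adj D' (translate T (inl i)) (translate T (ext b p))
                  = twisted_adj D (inl i) (ext b p).
  rewrite translate_ext [translate _ _]/= !twisted_int_ext val_translate_int //=.
  case: eqP => //= pi; rewrite in_setsd in_setI inE pi eqxx -pi (valP p) !andbT.
  by case: (_ \in _) (_ \in _) b => [] [] [].
case: (gammaP x) (gammaP y) => [i|b p] [j|c q] //.
  by rewrite translate_ext /= !twisted_extC -intext translate_ext.
rewrite !translate_ext !twisted_ext_ext; case: eqP => //= ->.
rewrite DD'; last exact: (valP p).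
by case: b c (_ \in _) (_ \in _) (D _) => [] [] [] [] [].
Qed.
End EvenTranslation.
End Gadgets.

(** * Non-isomorphism *)

Section NonIsomorphism.
Variable G : ugraph.
Hypothesis irrG : irreflexive (@adj G).
Implicit Types (x y : gamma_vertex G) (D : pred (G * G)).

Definition fibre x : G + G * G :=
  match x with
  | vint i => inl (val i).1
  | vexta p | vextb p => inr (val p)
  end.

Lemma fibre_ext b (p : arc G) : fibre (ext b p) = inr (val p).
Proof. by case: b. Qed.

Definition bits x : {set G * G} :=
  match x with
  | vint i => (val i).2
  | vexta p => [set val p]
  | vextb _ => set0
  end.

Lemma mem_bits_ext b (p : arc G) : (val p \in bits (ext b p)) = b.
Proof. by case: b; rewrite /= !inE ?eqxx. Qed.

Definition fadd x y := translate (bits y) x.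

Lemma fadd_ext b c (p : arc G) : fadd (ext b p) (ext c p) = ext (b (+) c) p.
Proof. by rewrite /fadd translate_ext mem_bits_ext. Qed.

Lemma bits_incident (i : internal G) :
  bits (inl i) :&: incident (val i).1 = bits (inl i).
Proof. by case/andP: (valP i) => /setIidPl. Qed.

Variant same_fibre : gamma_vertex G -> gamma_vertex G -> Prop :=
  | SameInt (i j : internal G) of (val i).1 = (val j).1 :
      same_fibre (inl i) (inl j)
  | SameExt b c (p : arc G) : same_fibre (ext b p) (ext c p).

Lemma fibreP x y : fibre x = fibre y -> same_fibre x y.
Proof.
case: (gammaP x) (gammaP y) => [i|b p] [j|c q]; rewrite ?fibre_ext //=.
- by case=> ?; constructor.
- by case=> /val_inj->; constructor.
Qed.

Lemma val_fadd_int (i j : internal G) : (val i).1 = (val j).1 ->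
  exists2 k : internal G, fadd (inl i) (inl j) = inl k &
    val k = ((val i).1, setsd (val i).2 (val j).2).
Proof.
move=> ij; eexists; first by [].
have incj : bits (inl j) :&: incident (val i).1 = (val j).2.
  by rewrite ij bits_incident.
by rewrite val_translate_int incj //; case/andP: (valP j).
Qed.

Lemma fibre_fadd x y : fibre x = fibre y -> fibre (fadd x y) = fibre x.
Proof.
case/fibreP=> [i j /val_fadd_int[k -> /= ->] //|b c p].
by rewrite fadd_ext !fibre_ext.
Qed.

Lemma fadd_inj x y z : fibre x = fibre z -> fibre y = fibre z ->
  fadd x z = fadd y z -> x = y.
Proof.
case: (gammaP x) (gammaP y) (gammaP z) => [i|b p] [j|c q] [k|d r];
  rewrite ?fibre_ext => xz yz //.
- case: xz yz => ik [jk]; have [i' -> iE] := val_fadd_int ik; have [j' -> jE] := val_fadd_int jk.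
  move=> [ij]; move: jE; rewrite -ij iE => -[_ /setP ijE].
  congr inl; apply: val_inj; rewrite [LHS]surjective_pairing.
  rewrite [RHS]surjective_pairing ik jk; congr (_, _); apply/setP => p.
  by have := ijE p; rewrite !in_setsd => /addIb.
- case: xz yz => /val_inj-> [/val_inj->].
  by rewrite !fadd_ext => /ext_inj[/addIb-> _].
Qed.

(** On a link the two sides differ by the bit [D] in both summands, and this bit cancels in the
    sum. *)
Lemma fadd_adj D x x' y y' : fibre x = fibre x' -> fibre y = fibre y' ->
  twisted_adj D x y -> twisted_adj D x' y' ->
  twisted_adj pred0 (fadd x x') (fadd y y').
Proof.
have intext (i j : internal G) b c (p : arc G) : (val i).1 = (val j).1 ->
    twisted_adj D (inl i) (ext b p) -> twisted_adj D (inl j) (ext c p) ->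
    twisted_adj pred0 (fadd (inl i) (inl j)) (fadd (ext b p) (ext c p)).
  move=> ij; have [k -> kE] := val_fadd_int ij; rewrite fadd_ext.
  rewrite !twisted_int_ext kE => /andP[-> /eqP<-] /andP[_ /eqP<-] /=.
  by rewrite in_setsd.
move=> /fibreP[i j ij|b c p] /fibreP[k l kl|d e q] //.
- exact: intext.
- have := intext _ _ b c p kl; have [m -> _] := val_fadd_int kl.
  by rewrite fadd_ext !twisted_extC.
rewrite !fadd_ext !twisted_ext_ext => /andP[-> /eqP bd] /andP[_ /eqP ce].
by rewrite addbACA bd ce addbb.
Qed.

Definition homs D D' : {set {ffun gamma_vertex G -> gamma_vertex G}} :=
  [set h : {ffun gamma_vertex G -> gamma_vertex G} | [forall x, forall y,
     twisted_adj D x y ==> twisted_adj D' (h x) (h y)]].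

Lemma homsP D D' (h : {ffun gamma_vertex G -> gamma_vertex G}) :
  reflect (forall x y, twisted_adj D x y -> twisted_adj D' (h x) (h y))
          (h \in homs D D').
Proof.
rewrite inE; apply: (iffP forallP) => [hP x y xy|hP x].
  exact: (implyP (forallP (hP x) y)).
by apply/forallP => y; apply/implyP/hP.
Qed.

(** The image of i(u, {}) is an internal vertex of the same gadget, whose even set is [S u]. Since
    i(u, {}) is adjacent to every b(u, u'), this set dictates the images of all b vertices; their
    links then impose on [S] the relation refuted by [no_even_section]. *)
Lemma no_fibred_hom (v w : G) (h : {ffun gamma_vertex G -> gamma_vertex G}) :
  adj v w -> h \in homs pred0 (edge_is v w) ->
  ~ (forall x, fibre (h x) = fibre x).
Proof.
move=> vw /homsP hP hf; pose S u := bits (h (inl (empty_int u))).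
have hint u : exists2 i : internal G, h (inl (empty_int u)) = inl i & (val i).1 = u.
  have := hf (inl (empty_int u)); case: (gammaP (h _)) => [i [iu]|b p].
    by exists i.
  by rewrite fibre_ext.
have hext (p : arc G) : h (ext false p) = ext (val p \in S (val p).1) p.
  have := hf (ext false p); have [i hi iu] := hint (val p).1.
  have /hP : twisted_adj pred0 (inl (empty_int (val p).1)) (ext false p).
    by rewrite twisted_int_ext SubK in_set0 !eqxx.
  case: (gammaP (h (ext _ _))) => [j|b q]; first by rewrite fibre_ext.
  rewrite /S hi twisted_int_ext => /andP[_ /eqP qb]; rewrite !fibre_ext.
  by case=> /val_inj qp; rewrite -qb qp.
apply: (no_even_section irrG vw (S := S)).
- by move=> u; rewrite /S; have [i -> <-] := hint u; case/andP: (valP i).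
- by move=> u; rewrite /S; have [i -> _] := hint u; case/andP: (valP i).
move=> p pG; have sG : adj (swap p).1 (swap p).2 by rewrite adj_sym.
have /hP : twisted_adj pred0 (ext false (Sub p pG)) (ext false (Sub (swap p) sG)).
  by rewrite twisted_ext_ext !SubK !eqxx.
by rewrite !hext twisted_ext_ext !SubK => /andP[_ /eqP].
Qed.

Lemma card_homs_lt (v w : G) : adj v w ->
  #|homs pred0 (edge_is v w)| < #|homs pred0 pred0|.
Proof.
move=> vw; set H := homs _ (edge_is v w).
pose ref (h : {ffun gamma_vertex G -> gamma_vertex G}) :=
  (* On [H] the default is never taken, so the reference depends only on the fibres that [h] visits.
     Hence [shift h] determines first the reference and then [h]. *)
  odflt h [pick h' in H | [forall x, fibre (h' x) == fibre (h x)]].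
have refP h : h \in H -> ref h \in H /\ forall x, fibre (h x) = fibre (ref h x).
  rewrite /ref => hH; case: pickP => [h' /andP[h'H /forallP fE]|_] //=.
  by split=> // x; apply/esym/eqP.
have eq_ref h h' : h \in H -> h' \in H ->
    (forall x, fibre (h x) = fibre (h' x)) -> ref h = ref h'.
  move=> hH h'H fE; rewrite /ref.
  rewrite (eq_pick (Q := [pred k in H | [forall x, fibre (k x) == fibre (h' x)]])).
    by case: pickP => // /(_ h') /=; rewrite h'H /= => /negbT/forallPn[x]; rewrite eqxx.
  by move=> k /=; congr (_ && _); apply: eq_forallb => x; rewrite fE.
pose shift (h : {ffun gamma_vertex G -> gamma_vertex G}) :=
  [ffun x => fadd (h x) (ref h x)].
have fibre_shift h x : h \in H -> fibre (shift h x) = fibre (h x).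
  by move=> /refP[_ fE]; rewrite ffunE fibre_fadd.
have shift_inj : {in H &, injective shift}.
  move=> h h' hH h'H hh'; have fE x : fibre (h x) = fibre (h' x).
    by rewrite -fibre_shift // hh' fibre_shift.
  have [_ fh] := refP _ hH; have [_ fh'] := refP _ h'H.
  apply/ffunP => x; move/ffunP/(_ x): hh'; rewrite !ffunE (eq_ref _ _ hH h'H fE).
  by apply: fadd_inj; rewrite ?fE fh'.
rewrite -(card_in_imset shift_inj).
pose idh := [ffun x : gamma_vertex G => x].
have idP : idh \in homs pred0 pred0 by apply/homsP => x y; rewrite !ffunE.
rewrite (cardsD1 idh (homs _ _)) idP ltnS; apply: subset_leq_card.
apply/subsetP => _ /imsetP[h hH ->]; rewrite in_setD1; apply/andP; split.
  apply/eqP => /ffunP hid; apply: (no_fibred_hom vw hH) => x.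
  by rewrite -fibre_shift // hid ffunE.
have [/homsP rP fE] := refP _ hH; apply/homsP => x y xy; rewrite !ffunE.
by apply: fadd_adj (rP _ _ xy) => //; move/homsP: hH; apply.
Qed.

Theorem Gamma_not_isomorphic (v w : G) : adj v w ->
  ~ isomorphic (Gamma G) (GammaTilde v w).
Proof.
move=> vw [f [g fK gK] f_adj].
have := card_homs_lt vw; rewrite ltnNge => /negP; apply.
pose comp (h : {ffun gamma_vertex G -> gamma_vertex G}) :=
  [ffun x => f (h x) : gamma_vertex G].
have comp_inj : injective comp.
  by move=> h h' /ffunP hh'; apply/ffunP => x; have := hh' x; rewrite !ffunE => /(can_inj fK).
rewrite -(card_imset _ comp_inj); apply: subset_leq_card.
apply/subsetP => _ /imsetP[h /homsP hP ->]; apply/homsP => x y /hP.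
by rewrite -gamma_adjE -[gamma_adj _ _]f_adj !ffunE.
Qed.
End NonIsomorphism.

(** * Counting logic *)

Lemma csat_free m (K : ugraph) (phi : cformula m) (s s' : 'I_m -> K) :
  {in free_vars phi, s =1 s'} -> csat s phi = csat s' phi.
Proof.
elim: phi s s' => [x y|x y|phi IH|phi IH psi IH'|phi IH psi IH'|i x phi IH] s s' /= ss'.
- by rewrite !ss' // !inE eqxx ?orbT.
- by rewrite !ss' // !inE eqxx ?orbT.
- by rewrite (IH s s').
- by rewrite (IH s s') ?(IH' s s') // => y ys; apply: ss'; rewrite inE ys ?orbT.
- by rewrite (IH s s') ?(IH' s s') // => y ys; apply: ss'; rewrite inE ys ?orbT.
congr (_ <= _); apply: eq_card => u; rewrite !inE; apply: IH => y yphi.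
by case: eqP => // /eqP yx; apply: ss'; rewrite !inE yx.
Qed.

Lemma ctrue_csat m (K : ugraph) (phi : cformula m) (s : 'I_m -> K) :
  sentence phi -> ctrue K phi <-> csat s phi.
Proof.
move=> /eqP phi0; split=> [|sphi s']; first exact.
by rewrite (csat_free (s' := s)) // => x; rewrite phi0 inE.
Qed.

Section CountingEquivalence.
Variables (m k : nat).
Hypothesis km : k.+2 <= m.
Let G := complete_graph m.
Variables v w : G.
Hypothesis vw : adj v w.
Implicit Types (s t : 'I_k.+1 -> gamma_vertex G) (T : {set G * G}).

Let irrG : irreflexive (@adj G).
Proof. by move=> x; apply: negbTE; rewrite negbK. Qed.

(* A translation by T carries Gamma to GammaTilde except that the twist sits  *)
(* on the edge (u, q), where it is invisible as no variable lies in X_u.      *)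
Definition matched s t := exists T u q,
  [/\ forall a, ~~ odd #|T :&: incident a|, u != q,
      forall p, edge_is v w p = edge_is u q p (+) (p \in T) (+) (swap p \in T),
      forall y, t y = translate T (s y) & forall y, gadget (s y) != u].

(** Both links over the edge uq have an end in X_u. *)
Lemma twisted_away (u q : G) (x y : gamma_vertex G) :
  gadget x != u -> gadget y != u ->
  twisted_adj (edge_is u q) x y = twisted_adj pred0 x y.
Proof.
case: (gammaP x) (gammaP y) => [i|b p] [j|c r]; rewrite ?twisted_extC ?twisted_int_ext //.
rewrite !gadget_ext !twisted_ext_ext => pu ru.
case: eqP => // rp; move: ru; rewrite rp /edge_is => ru; congr (_ && (_ == _)).
case: (val p =P (u, q)) => [pE|_]; first by rewrite pE eqxx in pu.
by apply/negbTE; apply: contra ru => /eqP->; rewrite /= eqxx.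
Qed.

Lemma matched_csat (phi : cformula k.+1) s t : matched s t ->
  @csat _ (Gamma G) s phi = @csat _ (GammaTilde v w) t phi.
Proof.
elim: phi s t => [x y|x y|phi IH|phi IH psi IH'|phi IH psi IH'|i x phi IH] s t st /=.
- case: st => T [u [q [evT _ _ tE _]]].
  by rewrite !tE (inj_eq (can_inj (translateK evT))).
- case: st => T [u [q [evT _ TE tE su]]].
  rewrite gamma_adjE -(@twisted_away u q) // !tE.
  by apply/esym; apply: (translate_adj evT) => p _; apply: TE.
- by rewrite (IH s t).
- by rewrite (IH s t) ?(IH' s t).
- by rewrite (IH s t) ?(IH' s t).
case: st => T [u [q [evT uq TE tE su]]].
(* The [k] variables other than [x] occupy at most [k] gadgets; together with X_u this excludes at
   most [k.+1] of the [m] gadgets. *)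
have [u' u'P] : exists u', u' \notin u |: [set gadget (s y) | y in [set~ x]].
  apply/existsP; rewrite -negb_forall; apply/negP => /forallP allP.
  have : m <= k.+1; last by rewrite leqNgt km.
  have -> : m = #|G| by rewrite card_ord.
  have <- : #|[set: 'I_k.+1]| = k.+1 by rewrite cardsT card_ord.
  rewrite (cardsD1 x) inE setTD; apply: leq_trans (_ : #|u |: _| <= _).
    by rewrite -[X in X <= _]cardsT; apply/subset_leq_card/subsetP => a _; apply: allP.
  by rewrite cardsU1; apply: leq_add; [case: (_ \in _) | apply: leq_imset_card].
move: u'P; rewrite in_setU1 negb_or => /andP[u'u u's].
pose T' := setsd T (setsd [set (u, q)] [set (u, u')]).
have incu q' : u != q' -> (u, q') \in incident u by move=> uq'; rewrite inE eqxx.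
have evT' a : ~~ odd #|T' :&: incident a|.
  have [->|au] := eqVneq a u; last first.
    suff -> : T' :&: incident a = T :&: incident a by exact: evT.
    apply/setP => p; rewrite !in_setI !in_setsd !in_set1.
    have [pa|] := boolP (p \in incident a); rewrite ?andbF //.
    suff pu q' : (p == (u, q')) = false by rewrite !pu !addbF.
    apply: contraNF au => /eqP pE; move: pa; rewrite pE inE => /andP[/eqP/= -> _].
    exact: eqxx.
  have -> : T' :&: incident u =
            setsd (T :&: incident u) (setsd [set (u, q)] [set (u, u')]).
    apply/setP => p; rewrite !(in_setI, in_setsd, in_set1).
    have [|pu] := boolP (p \in incident u); rewrite ?andbT // !andbF.
    suff pE q' : u != q' -> (p == (u, q')) = false by rewrite !pE // eq_sym.
    by move=> /incu uq'; apply: contraNF pu => /eqP->.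
  by rewrite !odd_card_setsd !cards1 (negPf (evT u)).
(* The bijection used to match witnesses. A witness outside X_u leaves X_u free, and the twist stays
   on uq; a witness inside X_u calls for [T'], which puts the twist on uu', next to the free gadget
   X_u'. Since [T] and [T'] agree outside X_u, the images of the other variables do not depend on
   the case. *)
pose F a := translate (if gadget a == u then T' else T) a.
have gF a : gadget (F a) = gadget a by rewrite /F; case: ifP => _; apply: gadget_translate.
have FK : involutive F.
  by move=> a; rewrite {1}/F gF /F; case: ifP => _; apply: translateK.
congr (_ <= _).
rewrite -(card_imset _ (inv_inj FK)); apply: eq_card => b; rewrite inE.
rewrite -{1}[b]FK (mem_imset _ _ (inv_inj FK)) inE -{2}[b]FK; apply: IH.
move: (F b) => {b} a.
case: (eqVneq (gadget a) u) => au; last first.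
  exists T, u, q; split=> // y; case: ifP => // _.
  by rewrite /F (negPf au).
exists T', u', u; split=> //.
- have edgeC a1 a2 p : @edge_is G a1 a2 p = edge_is a2 a1 p by rewrite /edge_is orbC.
  move=> p; rewrite TE (edgeC u') !edge_is_addb 1?[u == u']eq_sym // !(in_setsd, in_set1).
  move: (p == (u, q)) (p == (u, u')) (swap p == (u, q)) (swap p == (u, u')).
  by case: (p \in T) (swap p \in T) => [] [] [] [] [] [].
- move=> y; case: ifP => yx; first by rewrite /F au eqxx.
  rewrite tE; apply: translate_eq => p pg; rewrite !(in_setsd, in_set1).
  suff pu u1 : (p == (u, u1)) = false by rewrite !pu !addbF.
  by apply: contraNF (su y) => /eqP pE; rewrite -pg pE.
- move=> y; case: ifP => yx; first by rewrite au eq_sym.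
  by apply: contraNneq u's => <-; apply: imset_f; rewrite !inE yx.
Qed.

Theorem Gamma_not_WL_distinguished :
  ~ WL_distinguished k (Gamma G) (GammaTilde v w).
Proof.
have nvw : v != w by apply: contraTneq vw => ->; rewrite irrG.
case=> phi phi0; pose s := fun _ : 'I_k.+1 => inl (empty_int w) : gamma_vertex G.
have st : matched s s.
  (* Initially the twist is in its own place and all variables sit in X_w, so X_v is free. *)
  exists set0, v, w; split=> // [a|p|y|y].
  - by rewrite set0I cards0.
  - by rewrite !inE !addbF.
  - by rewrite translate0.
  - by rewrite eq_sym.
have [satG trueG] := @ctrue_csat _ (Gamma G) phi s phi0.
have [satH trueH] := @ctrue_csat _ (GammaTilde v w) phi s phi0.
rewrite (matched_csat _ st) in satG trueG.
by case=> [[/satG/trueH]|[+ /satH/trueG]].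
Qed.
End CountingEquivalence.

(** * The Seurat game *)

Section SeuratStrategies.
Variables (k : nat) (G H : ugraph).
Implicit Types p : position k.+1 G H.

Definition wins_at p : bool :=
  [exists P, (palette_class p.1 P == set0) != (palette_class p.2 P == set0)]
  || [exists P1, exists P2, palette_adj p.1 P1 P2 != palette_adj p.2 P1 P2].

Lemma wins_at_sound p : wins_at p -> forall_wins_at p.
Proof.
case/orP=> [/existsP[P PP]|/existsP[P1 /existsP[P2 PP]]]; first by left; exists P.
by right; exists P1, P2.
Qed.

Definition forces (W : position k.+1 G H -> bool) p
    (m : 'I_k.+1 * ({set G} + {set H})) : bool :=
  match m.2 with
  | inl A => [forall B, W (paint p.1 m.1 A, paint p.2 m.1 B)]
  | inr B => [forall A, W (paint p.1 m.1 A, paint p.2 m.1 B)]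
  end.

Fixpoint win_in r p : bool :=
  wins_at p || (if r is r'.+1 then [exists m, forces (win_in r') p m] else false).

Lemma forces_sub (W W' : position k.+1 G H -> bool) p m :
  (forall q, W q -> W' q) -> forces W p m -> forces W' p m.
Proof.
by move=> WW'; case: m => c [A|A] /forallP WA; apply/forallP => B; apply: WW'.
Qed.

Lemma win_in_leq r r' p : r <= r' -> win_in r p -> win_in r' p.
Proof.
elim: r r' p => [|r IH] [|r'] p //=; first by rewrite orbF => _ ->.
move=> rr' /orP[->//|/existsP[m mW]]; apply/orP; right; apply/existsP; exists m.
by apply: forces_sub mW => q; apply: IH.
Qed.

Lemma win_in_forall_wins r :
  win_in r (start k.+1 G H) -> seurat_forall_wins k.+1 G H.
Proof.
move=> r_win; pose st := start k.+1 G H.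
pose best t p := odflt (ord0, inl set0) [pick m | forces (win_in t) p m].
(* In round [t] the history has [t.+1] positions, so the difference is the number of rounds left
   after the present move. *)
exists (fun hist => best (r - size hist) (last st hist)) => p [p0 pS].
suff: forall t, t <= r -> (exists t', wins_at (p t')) \/ win_in (r - t) (p t).
  case/(_ r (leqnn r)) => [[t /wins_at_sound]|]; first by exists t.
  by rewrite subnn /= orbF => /wins_at_sound; exists r.
elim=> [_|t IH tr]; first by right; rewrite subn0 p0.
case: (IH (ltnW tr)) => [|]; first by left.
rewrite -subSS subSn //= => /orP[?|t_win]; first by left; exists t.
right; have := pS t; rewrite size_mkseq mkseqS last_rcons /best.
case: pickP => [|no_m]; last by case/existsP: t_win => m; rewrite no_m.
by move=> [c [A|A]] /forallP W [B ->]; apply: W.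
Qed.
End SeuratStrategies.

(** * Properties of two sets that the first player can exploit *)

Definition set_relation := forall K : ugraph, {set K} -> {set K} -> bool.

Definition other (c : 'I_2) : 'I_2 := if c == ord0 then ord_max else ord0.

Lemma otherK : involutive other.
Proof. by case=> [[|[|c]] //= ci]; apply: val_inj. Qed.

Lemma other_neq c : (c == other c) = false.
Proof. by case: c => [[|[|c]]]. Qed.

(* The analogue of being expressible with two set variables: the first player *)
(* wins, in a bounded number of rounds, from any position in which the        *)
(* relation holds of the two colour sets in only one of the graphs.           *)
Definition definable (Q : set_relation) : Prop :=
  exists r, forall (G H : ugraph) (g : colouring 2 G) (h : colouring 2 H) c,
    Q G (g c) (g (other c)) != Q H (h c) (h (other c)) ->
    @win_in 1 G H r (g, h).

Section Definability.
Implicit Types Q R : set_relation.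

Lemma eq_definable Q R :
  (forall K A B, Q K A B = R K A B) -> definable Q -> definable R.
Proof. by move=> QR [r rP]; exists r => G H g h c; rewrite -!QR; apply: rP. Qed.

Lemma definable_swap Q : definable Q -> definable (fun K A B => Q K B A).
Proof.
by case=> r rP; exists r => G H g h c; have := rP G H g h (other c); rewrite otherK.
Qed.

Lemma definable_neg Q : definable Q -> definable (fun K A B => ~~ Q K A B).
Proof.
by case=> r rP; exists r => G H g h c; rewrite (inj_eq negb_inj); apply: rP.
Qed.

Lemma definable_and Q R :
  definable Q -> definable R -> definable (fun K A B => Q K A B && R K A B).
Proof.
move=> [r rP] [r' rP']; exists (maxn r r') => G H g h c QR.
have [QE|/rP] := eqVneq (Q G (g c) (g (other c))) (Q H (h c) (h (other c))).
  apply: win_in_leq (leq_maxr _ _) _; apply: (rP' _ _ _ _ c).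
  by apply: contraNneq QR => ->; rewrite QE.
exact/win_in_leq/leq_maxl.
Qed.

(** The first player paints a witness, in the graph that has one, with the other colour; every
    answer fails [Q]. Overwriting that colour is why the result may depend on [A] only. *)
Lemma definable_exists Q :
  definable Q -> definable (fun K A _ => [exists B, Q K A B]).
Proof.
case=> r rP; exists r.+1 => G H g h c ex_neq; apply/orP; right; apply/existsP.
have [/existsP[B QB]|/existsPn GQ] := boolP [exists B, Q G (g c) B].
  have /existsPn HQ : ~~ [exists B, Q H (h c) B].
    by apply: contraNN ex_neq => ->; apply/eqP/existsP; exists B.
  exists (other c, inl B); apply/forallP => B'; apply: (rP _ _ _ _ c).
  by rewrite !ffunE eqxx other_neq QB (negPf (HQ B')).
have [/existsP[B QB]|/existsPn HQ] := boolP [exists B, Q H (h c) B].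
  exists (other c, inr B); apply/forallP => B'; apply: (rP _ _ _ _ c).
  by rewrite !ffunE eqxx other_neq QB (negPf (GQ B')).
case/eqP: ex_neq => /=; apply/existsP/existsP => -[B]; first by rewrite (negPf (GQ B)).
by rewrite (negPf (HQ B)).
Qed.

Lemma definable_forall Q :
  definable Q -> definable (fun K A _ => [forall B, Q K A B]).
Proof.
move=> /definable_neg/definable_exists/definable_neg; apply: eq_definable => K A _.
by rewrite negb_exists; apply: eq_forallb => B; rewrite negbK.
Qed.

Lemma mem_palette (G H : ugraph) (g : colouring 2 G) (h : colouring 2 H) u u' c :
  palette g u = palette h u' -> (u \in g c) = (u' \in h c).
Proof. by move/setP/(_ c); rewrite !inE. Qed.

Lemma definable_nonempty (f : bool -> bool -> bool) :
  definable (fun K A B => [exists u : K, f (u \in A) (u \in B)]).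
Proof.
exists 0 => G H g h c; apply: contraNT; rewrite /= orbF negb_or.
case/andP=> /existsPn same _; apply/eqP => /=; apply/existsP/existsP => -[u fu].
  have := same (palette g u); rewrite negbK => /eqP palE.
  have /set0Pn[u'] : palette_class h (palette g u) != set0.
    by rewrite -palE; apply/set0Pn; exists u; rewrite inE.
  by rewrite inE => /eqP uu'; exists u'; rewrite !(mem_palette _ uu').
have := same (palette h u); rewrite negbK => /eqP palE.
have /set0Pn[u'] : palette_class g (palette h u) != set0.
  by rewrite palE; apply/set0Pn; exists u; rewrite inE.
by rewrite inE => /eqP uu'; exists u'; rewrite !(mem_palette _ uu').
Qed.

Lemma palette_adj_self n (K : ugraph) (g : colouring n K) u v :
  adj u v -> palette_adj g (palette g u) (palette g v).
Proof.
move=> uv; apply/existsP; exists u; rewrite inE eqxx.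
by apply/existsP; exists v; rewrite inE eqxx.
Qed.

Definition edge_between (K : ugraph) (X Y : {set K}) : bool :=
  [exists x in X, exists y in Y, adj x y].

Lemma edge_betweenP (K : ugraph) (X Y : {set K}) :
  reflect (exists x y, [/\ x \in X, y \in Y & adj x y]) (edge_between X Y).
Proof.
apply: (iffP exists_inP) => [[x xX /exists_inP[y yY xy]]|[x [y [xX yY xy]]]].
  by exists x, y.
by exists x => //; apply/exists_inP; exists y.
Qed.

(** Boolean combinations of the colours are unions of palette classes, so an edge present in only
    one graph is an instance of (C2) with no further move. *)
Lemma definable_edge (f e : bool -> bool -> bool)
    (X Y : forall K : ugraph, {set K} -> {set K} -> {set K}) :
  (forall K A B x, (x \in X K A B) = f (x \in A) (x \in B)) ->
  (forall K A B x, (x \in Y K A B) = e (x \in A) (x \in B)) ->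
  definable (fun K A B => edge_between (X K A B) (Y K A B)).
Proof.
move=> XE YE; exists 0 => G H g h c; apply: contraNT; rewrite /= orbF negb_or.
case/andP=> _ /existsPn same.
have palE P1 P2 : palette_adj g P1 P2 = palette_adj h P1 P2.
  by have /existsPn/(_ P2) := same P1; rewrite negbK => /eqP.
apply/eqP => /=; apply/edge_betweenP/edge_betweenP => -[x [y []]]; rewrite XE YE => fx ey xy.
  have := palette_adj_self g xy; rewrite palE => /exists_inP[x' + /exists_inP[y' + xy']].
  rewrite !inE => /eqP xx' /eqP yy'; exists x', y'.
  by rewrite XE YE !(mem_palette _ xx') !(mem_palette _ yy').
have := palette_adj_self h xy; rewrite -palE => /exists_inP[x' + /exists_inP[y' + xy']].
rewrite !inE => /eqP xx' /eqP yy'; exists x', y'.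
by rewrite XE YE !(mem_palette _ xx') !(mem_palette _ yy').
Qed.

Lemma definable_subset : definable (fun K A B => A \subset B).
Proof.
apply: eq_definable (definable_neg (definable_nonempty (fun a b => a && ~~ b))).
move=> K A B; rewrite negb_exists; apply/forallP/subsetP => AB x.
  by move=> xA; have := AB x; rewrite xA negbK.
by rewrite negb_and negbK -implybE; apply/implyP/AB.
Qed.

(** By induction: a set has at most m + 1 elements iff all its proper subsets have at most m. *)
Lemma definable_card_leq m : definable (fun K A _ => #|A| <= m).
Proof.
elim: m => [|m IH].
  apply: eq_definable (definable_neg (definable_nonempty (fun a _ => a))).
  move=> K A _; rewrite leqn0 cards_eq0; apply/existsPn/eqP => [A0|-> x].
    by apply/setP => x; rewrite inE; apply: negbTE.
  by rewrite inE.
have sub := definable_swap definable_subset.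
have := definable_and sub (definable_neg definable_subset).
move/definable_and => /(_ _ (definable_neg (definable_swap IH))).
move=> /definable_neg/definable_forall; apply: eq_definable => K A _.
apply/forallP/idP => [small|Am B].
  have [->|[x xA]] := set_0Vmem A; first by rewrite cards0.
  rewrite (cardsD1 x) xA; have := small (A :\ x); rewrite subD1set negb_and !negbK.
  by case/orP=> // /subsetP/(_ x xA); rewrite setD11.
apply/negP => /andP[/andP[BA nAB]]; rewrite -ltnNge => mB.
have : #|B| < #|A| by apply: proper_card; rewrite properE BA.
by move/leq_trans/(_ Am); rewrite ltnS leqNgt mB.
Qed.

Lemma definable_card_eq m : definable (fun K A _ => #|A| == m).
Proof.
have := definable_card_leq; case: m => [/(_ 0)|m cardP].
  by apply: eq_definable => K A _; rewrite leqn0.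
apply: eq_definable (definable_and (cardP m.+1) (definable_neg (cardP m))).
by move=> K A _; rewrite -ltnNge -eqn_leq.
Qed.
End Definability.

(** * Pairs of vertices joined by walks of length three *)

Section LinkedPairs.
Variable K : ugraph.
Implicit Types A B C : {set K}.

(** With [C] a pair in one colour, a single set [B] must carry both the auxiliary vertices and one
    end of the pair, so as to tell the two ends apart: [B] is {z, x} here and {x, e, f} in
    [has_bridge]. *)
Definition has_common C : bool := [exists B : {set K},
  [&& #|B| == 2, edge_between (B :\: C) (B :&: C)
    & edge_between (B :\: C) (C :\: B)]].

Definition has_bridge C : bool := [exists B : {set K},
  [&& #|B| == 3, edge_between (B :&: C) (B :\: C),
      edge_between (B :\: C) (B :\: C) & edge_between (B :\: C) (C :\: B)]].

Definition spread m A : bool := (#|A| == m) &&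
  [forall C : {set K}, (C \subset A) && (#|C| == 2) ==>
     ~~ has_common C && has_bridge C].

Hypothesis irrK : irreflexive (@adj K).

Lemma adj_neq (x y : K) : adj x y -> x != y.
Proof. by apply: contraTneq => ->; rewrite irrK. Qed.

Lemma has_commonP (x y : K) : x != y ->
  reflect (exists z, adj z x && adj z y) (has_common [set x; y]).
Proof.
move=> xy; apply: (iffP existsP) => [[B /and3P[B2]]|[z /andP[zx zy]]].
  case/edge_betweenP=> z [a [zBC aBC za]] /edge_betweenP[z' [a' [z'BC a'BC za']]].
  have zE : z' = z.
    apply/eqP; apply/negP => /negP nz; move: zBC aBC z'BC; rewrite !inE.
    move=> /andP[zC zB] /andP[aB aC] /andP[z'C z'B].
    have : #|z |: (a |: [set z'])| <= #|B|.
      by apply/subset_leq_card/subsetP => u; rewrite !inE => /or3P[] /eqP->.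
    rewrite !cardsU1 cards1 (eqP B2) !inE (eq_sym z z') (negPf nz) (negPf (adj_neq za)).
    by rewrite (negPf (_ : a != z')) //; apply: contraNneq z'C => <-.
  exists z; rewrite zE in za'; move: aBC a'BC; rewrite !inE.
  move=> /andP[aB /orP[]/eqP aE] /andP[a'B /orP[]/eqP a'E]; subst a a';
    rewrite ?za ?za' //; by rewrite aB in a'B.
have zneq := adj_neq zx; have zneq' := adj_neq zy.
exists [set z; x]; rewrite cards2 zneq /=; apply/andP; split; apply/edge_betweenP.
  by exists z, x; rewrite !inE !eqxx !orbT (negPf zneq) (negPf zneq').
exists z, y; rewrite !inE !eqxx !orbT (negPf zneq) (negPf zneq') /= (eq_sym y).
by rewrite (negPf zneq') eq_sym (negPf xy).
Qed.

(** Exactly two points of [B] lie outside [C], and they are adjacent. The edges to the two ends of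
    the pair leave from different ones, as otherwise that point would be a common neighbour. *)
Lemma bridge_walk (x y : K) : x != y ->
  ~~ has_common [set x; y] -> has_bridge [set x; y] ->
  exists e f, [/\ adj x e, adj e f & adj f y].
Proof.
move=> xy; set C := [set x; y] => no_common /existsP[B /and4P[B3]].
case/edge_betweenP=> a [e [aBC eBC ae]] /edge_betweenP[e' [f' [e'BC f'BC ef']]].
case/edge_betweenP=> f [b [fBC bBC fb]].
have BC2 : #|B :\: C| <= 2.
  have := cardsID C B; rewrite (eqP B3) (cardsD1 a (B :&: C)) aBC.
  by rewrite -addnA add1n => -[<-]; apply: leq_addl.
have in_ef z : z \in B :\: C -> (z == e') || (z == f').
  move=> zBC; apply: contraLR BC2 => /norP[ze zf]; rewrite -ltnNge.
  apply: leq_trans (_ : #|z |: [set e'; f']| <= _).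
    by rewrite cardsU1 cards2 !inE (negPf ze) (negPf zf) (adj_neq ef').
  by apply/subset_leq_card/subsetP => u; rewrite !inE => /or3P[] /eqP->;
    [move: zBC | move: e'BC | move: f'BC]; rewrite !inE.
have ab_xy : (a = x /\ b = y) \/ (a = y /\ b = x).
  move: aBC bBC; rewrite !inE => /andP[aB /orP[]/eqP aE] /andP[bB /orP[]/eqP bE];
    subst a b; [by rewrite aB in bB | by left | by right | by rewrite aB in bB].
have nef : e != f.
  apply: contraNneq no_common => ef; apply/(has_commonP xy); exists e.
  have eb : adj e b by rewrite ef.
  have ea : adj e a by rewrite adj_sym.
  by case: ab_xy => -[<- <-]; rewrite ea eb.
have ef : adj e f.
  case/orP: (in_ef _ eBC) (in_ef _ fBC) nef => /eqP-> /orP[]/eqP->; rewrite ?eqxx //.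
  by rewrite adj_sym.
case: ab_xy => -[aE bE]; subst a b; first by exists e, f.
by exists f, e; split; rewrite adj_sym.
Qed.

Lemma walk_bridge (x y e f : K) : x != y -> ~~ adj x y ->
  adj x e -> adj e f -> adj f y -> has_bridge [set x; y].
Proof.
move=> xy nxy xe ef fy.
have ne : e != y by apply: contraNneq nxy => <-.
have nf : f != x by apply: contraNneq nxy => <-.
have xe' := adj_neq xe; have ef' := adj_neq ef; have fy' := adj_neq fy.
apply/existsP; exists (e |: [set x; f]).
rewrite cardsU1 cards2 !inE (eq_sym e x) (negPf xe') (negPf ef') (eq_sym x f) nf /=.
have eBC : e \in (e |: [set x; f]) :\: [set x; y].
  by rewrite !inE eqxx (eq_sym e x) (negPf xe') (negPf ne).
have fBC : f \in (e |: [set x; f]) :\: [set x; y].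
  by rewrite !inE eqxx (negPf nf) (negPf fy') !orbT.
apply/and3P; split; apply/edge_betweenP.
- by exists x, e; rewrite eBC !inE !eqxx !orbT.
- by exists e, f.
by exists f, y; rewrite fBC !inE (eq_sym y e) (negPf ne) (eq_sym y x) (negPf xy)
  (eq_sym y f) (negPf fy') eqxx orbT.
Qed.
End LinkedPairs.

Lemma definable_spread m : definable (fun K A _ => spread m A).
Proof.
have common : definable (fun K C _ => has_common C).
  apply: definable_exists; apply: definable_and.
    exact: definable_swap (definable_card_eq 2).
  apply: definable_and.
    apply: (@definable_edge (fun c b => b && ~~ c) (fun c b => b && c)
      (fun K C B => B :\: C) (fun K C B => B :&: C)) => K C B x; rewrite !inE //.
    exact: andbC.
  apply: (@definable_edge (fun c b => b && ~~ c) (fun c b => c && ~~ b)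
    (fun K C B => B :\: C) (fun K C B => C :\: B)) => K C B x; rewrite !inE;
    exact: andbC.
have bridge : definable (fun K C _ => has_bridge C).
  apply: definable_exists; apply: definable_and.
    exact: definable_swap (definable_card_eq 3).
  apply: definable_and; [|apply: definable_and].
  - apply: (@definable_edge (fun c b => b && c) (fun c b => b && ~~ c)
      (fun K C B => B :&: C) (fun K C B => B :\: C)) => K C B x; rewrite !inE //.
    exact: andbC.
  - apply: (@definable_edge (fun c b => b && ~~ c) (fun c b => b && ~~ c)
      (fun K C B => B :\: C) (fun K C B => B :\: C)) => K C B x; rewrite !inE;
    exact: andbC.
  apply: (@definable_edge (fun c b => b && ~~ c) (fun c b => c && ~~ b)
    (fun K C B => B :\: C) (fun K C B => C :\: B)) => K C B x; rewrite !inE;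
    exact: andbC.
apply: definable_and (definable_card_eq m) _.
have pair := definable_and (definable_swap definable_subset)
  (definable_swap (definable_card_eq 2)).
have good := definable_and (definable_neg common) bridge.
have := definable_neg (definable_and pair (definable_neg (definable_swap good))).
move/definable_forall; apply: eq_definable => K A _; apply: eq_forallb => C.
by rewrite negb_and negbK implybE.
Qed.

(** * Spread sets in Gamma and their absence in GammaTilde *)

Section SpreadGamma.
Variable G : ugraph.
Hypothesis irrG : irreflexive (@adj G).

Lemma twisted_irr D : irreflexive (@twisted_adj G D).
Proof.
move=> x; case: (gammaP x) => [i|b p] //; rewrite twisted_ext_ext.
case: eqP => // pE; have := valP p; have -> : (val p).2 = (val p).1.
  by rewrite [in RHS]pE.
by rewrite irrG.
Qed.

Lemma Gamma_irr : irreflexive (@adj (Gamma G)).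
Proof. by move=> x; rewrite /= gamma_adjE twisted_irr. Qed.

Lemma GammaTilde_irr (v w : G) : irreflexive (@adj (GammaTilde v w)).
Proof. exact: twisted_irr. Qed.

(** The vertices i(u, {}) work: i(u, {}), b(u, u'), b(u', u), i(u', {}) is a walk, and a common
    neighbour would belong to two gadgets. *)
Lemma Gamma_spread : (forall u v : G, u != v -> adj u v) ->
  exists A : {set Gamma G}, spread #|G| A.
Proof.
move=> complG; pose f (u : G) : Gamma G := inl (empty_int u).
have f_inj : injective f by move=> u u' [].
exists [set f u | u in G]; rewrite /spread card_imset // eqxx.
apply/forallP => C; apply/implyP => /andP[/subsetP CA /cards2P[x [y [xy CE]]]].
have /imsetP[u _ xE] : x \in f @: G by apply: CA; rewrite CE !inE eqxx.
have /imsetP[u' _ yE] : y \in f @: G by apply: CA; rewrite CE !inE eqxx orbT.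
have uu' : u != u' by rewrite -(inj_eq f_inj) -xE -yE.
have uG := complG _ _ uu'; have u'G : adj u' u by rewrite adj_sym.
rewrite {C CA}CE {x}xE {y}yE in xy *; apply/andP; split.
  apply/(has_commonP Gamma_irr xy) => -[z]; rewrite /= !gamma_adjE.
  case: (gammaP z) => [i|b p]; rewrite ?twisted_int_int // !twisted_extC.
  rewrite !twisted_int_ext !SubK /= => /andP[/andP[/eqP-> _] /andP[/eqP uE _]].
  by rewrite uE eqxx in uu'.
pose e := ext false (Sub (u, u') uG : arc G).
pose e' := ext false (Sub (u', u) u'G : arc G).
apply: (@walk_bridge (Gamma G) Gamma_irr _ _ e e') => //=;
  rewrite gamma_adjE ?twisted_extC ?twisted_int_ext ?twisted_ext_ext ?SubK;
  by rewrite ?in_set0 !eqxx.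
Qed.

Section WalksInGammaTilde.
Variables v w : G.
Hypothesis vw : adj v w.

Definition walk3 (x y : GammaTilde v w) : Prop :=
  exists e f, [/\ adj x e, adj e f & adj f y].

Lemma walk3_sym x y : walk3 x y -> walk3 y x.
Proof. by case=> e [f [xe ef fy]]; exists f, e; split; rewrite adj_sym. Qed.

Let adjE (x y : GammaTilde v w) : adj x y = twisted_adj (edge_is v w) x y.
Proof. by []. Qed.

(** Such a walk crosses exactly one link, and comparing the bits along it reveals whether that link
    is crossed. *)
Lemma walk3_int_int (i j : internal G) : walk3 (inl i) (inl j) ->
  exists p, [/\ p.1 = (val i).1, p.2 = (val j).1, adj p.1 p.2
    & (p \in (val i).2) (+) (swap p \in (val j).2) = edge_is v w p].
Proof.
case=> e [f []]; rewrite !adjE; case: (gammaP e) (gammaP f) => [k|b p] [l|c q] //.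
rewrite twisted_extC twisted_ext_ext !twisted_int_ext.
move=> /andP[/eqP pi /eqP pb] /andP[/eqP qp /eqP bc] /andP[/eqP qj /eqP qc].
exists (val p); rewrite -qp pb qc bc -qj qp; split=> //; exact: valP p.
Qed.

Lemma walk3_int_ext (i : internal G) b p :
  walk3 (inl i) (ext b p) -> (val i).1 = (val p).1.
Proof.
case=> e [f []]; rewrite !adjE; case: (gammaP e) => [k|c q] //.
rewrite twisted_int_ext => /andP[/eqP<- _].
case: (gammaP f) => [l|d r]; rewrite ?twisted_extC ?twisted_ext_ext ?twisted_int_ext.
  by move=> /andP[/eqP-> _] /andP[/eqP->].
by move=> /andP[/eqP-> _] /andP[/eqP->]; rewrite swapK.
Qed.

(** Two internal vertices are never adjacent, so the walk uses one link or three, and ends in a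
    neighbouring gadget. *)
Lemma walk3_ext_ext b c (p q : arc G) : walk3 (ext b p) (ext c q) ->
  (val p).2 = (val q).1 \/ (val q).2 = (val p).1.
Proof.
case=> e [f []]; rewrite !adjE.
case: (gammaP e) (gammaP f) => [k|d r] [l|d' r'];
  rewrite ?twisted_extC ?twisted_ext_ext ?twisted_int_ext ?twisted_int_int //.
- move=> /andP[/eqP-> _] /andP[/eqP<- _] /andP[/eqP-> _]; by right.
- move=> /andP[/eqP rE _] /andP[/eqP rl _] /andP[/eqP-> _]; left.
  by rewrite -rl rE.
move=> /andP[/eqP rE _] /andP[/eqP r'E _] /andP[/eqP-> _]; left.
by rewrite r'E rE.
Qed.

Lemma arc_neq (p : arc G) : (val p).1 != (val p).2.
Proof. by have := valP p; apply: contraTneq => ->; rewrite irrG. Qed.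

(** An internal [y] or [z] would force a loop in [G], so both are external. Two arcs that both start
    at the head of [p], or both end at its tail, cannot be consecutive without a loop. *)
Lemma walk3_triangle b p y z :
  walk3 (ext b p) y -> walk3 (ext b p) z -> walk3 y z ->
  (gadget y == (val p).2) != (gadget z == (val p).2).
Proof.
case: (gammaP y) (gammaP z) => [i|c q] [j|d r].
- move=> /walk3_sym/walk3_int_ext ip /walk3_sym/walk3_int_ext jp.
  by case/walk3_int_int=> a [a1 a2]; rewrite a1 a2 ip jp irrG.
- move=> /walk3_sym/walk3_int_ext ip pr /walk3_int_ext ir.
  case/walk3_ext_ext: pr => E; have := arc_neq p; have := arc_neq r.
    by rewrite E -ir ip eqxx.
  by rewrite E -ir ip eqxx.
- move=> pq /walk3_sym/walk3_int_ext ip /walk3_sym/walk3_int_ext iq.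
  case/walk3_ext_ext: pq => E; have := arc_neq p; have := arc_neq q.
    by rewrite E -iq ip eqxx.
  by rewrite E -iq ip eqxx.
move=> /walk3_ext_ext pq /walk3_ext_ext pr /walk3_ext_ext qr.
rewrite !gadget_ext; apply/eqP => qrE.
have := arc_neq q; have := arc_neq r; move: qrE.
case: eqP pq => [qp _|nq [/esym //|qp]]; case: eqP pr => [rp _|nr [/esym //|rp]] // _.
  by case: qr => ->; rewrite ?qp ?rp eqxx.
by case: qr => E; rewrite ?qp ?rp -?E ?qp ?rp eqxx.
Qed.

(* Four vertices pairwise joined by walks of length 3 are all internal, and   *)
(* lie in distinct gadgets.                                                   *)
Lemma GammaTilde_not_spread (A : {set GammaTilde v w}) :
  4 <= #|G| -> ~~ spread #|G| A.
Proof.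
move=> G4; apply/negP => /andP[/eqP cardA /forallP spreadA].
have walkA x y : x \in A -> y \in A -> x != y -> walk3 x y.
  move=> xA yA xy; have /implyP := spreadA [set x; y].
  rewrite cards2 xy andbT => /(_ _) /andP[]; last exact: (bridge_walk (@GammaTilde_irr v w)).
  by apply/subsetP => z; rewrite !inE => /orP[] /eqP->.
have intA x : x \in A -> exists i : internal G, x = inl i.
  case: (gammaP x) => [i _|b p pA]; first by exists i.
  (* This is where four vertices are needed: three further members of [A] would yield three pairwise
     distinct Booleans. *)
  have : 2 < #|A :\ ext b p| by move: G4; rewrite -cardA (cardsD1 (ext b p)) pA.
  case/card_gt2P=> [y1 [y2 [y3 [[]]]]]; rewrite !inE.
  move=> /andP[n1 A1] /andP[n2 A2] /andP[n3 A3] [n12 n23 n31].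
  have walkp y : y != ext b p -> y \in A -> walk3 (ext b p) y.
    by move=> ny yA; apply: walkA; rewrite // eq_sym.
  have := walk3_triangle (walkp _ n1 A1) (walkp _ n2 A2) (walkA _ _ A1 A2 n12).
  have := walk3_triangle (walkp _ n2 A2) (walkp _ n3 A3) (walkA _ _ A2 A3 n23).
  have := walk3_triangle (walkp _ n3 A3) (walkp _ n1 A1) (walkA _ _ A3 A1 n31).
  by do 3!case: (_ == (val p).2).
have gadget_inj : {in A &, injective (@gadget G)}.
  move=> x y xA yA; apply: contra_eq => xy; have := walkA x y xA yA xy.
  have [i ->] := intA x xA; have [j ->] := intA y yA.
  by case/walk3_int_int=> p [p1 p2 + _]; rewrite p1 p2; apply: contraTneq => /= ->; rewrite irrG.
have full : @gadget G @: A = [set: G].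
  by apply/eqP; rewrite eqEcard subsetT card_in_imset // cardA cardsT leqnn.
have int_of u : exists i : internal G, (inl i \in A) && ((val i).1 == u).
  have /imsetP[x xA ->] : u \in @gadget G @: A by rewrite full inE.
  by have [i xE] := intA x xA; exists i; rewrite -xE xA xE /= eqxx.
(* [A] has one internal vertex in each gadget; their even sets contradict [no_even_section]. *)
pose S u := (val (xchoose (int_of u))).2.
have chosen u := xchooseP (int_of u).
apply: (no_even_section irrG vw (S := S)) => [u|u|p pG].
- have /andP[_ /eqP uE] := chosen u; rewrite /S.
  by case/andP: (valP (xchoose (int_of u))); rewrite uE.
- by rewrite /S; case/andP: (valP (xchoose (int_of u))).
have [/andP[A1 /eqP E1] /andP[A2 /eqP E2]] := (chosen p.1, chosen p.2).
have neq : inl (xchoose (int_of p.1)) != inl (xchoose (int_of p.2)) :> gamma_vertex G.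
  apply: contraTneq pG => -[]/(congr1 val) E; have := congr1 fst E.
  by rewrite E1 E2 => ->; rewrite irrG.
have [q [q1 q2 _ qS]] := walk3_int_int (walkA _ _ A1 A2 neq).
have qp : q = p by rewrite [q]surjective_pairing [RHS]surjective_pairing q1 q2 E1 E2.
by move: qS; rewrite qp.
Qed.
End WalksInGammaTilde.

Theorem Gamma_seurat_forall_wins (v w : G) : 4 <= #|G| ->
  (forall u u' : G, u != u' -> adj u u') -> adj v w ->
  seurat_forall_wins 2 (Gamma G) (GammaTilde v w).
Proof.
move=> G4 complG vw; have [r rP] := definable_exists (definable_swap (definable_spread #|G|)).
apply: (@win_in_forall_wins 1 _ _ r); apply: (rP _ _ _ _ ord0) => /=.
have [A A_spread] := Gamma_spread complG.
have -> : [exists B : {set Gamma G}, spread #|G| B] by apply/existsP; exists A.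
suff -> : [exists B : {set GammaTilde v w}, spread #|G| B] = false by [].
by apply/negbTE/existsPn => B; apply: GammaTilde_not_spread.
Qed.
End SpreadGamma.

Theorem theorem5p1 (n : nat) :
  (3 <= n -> forall v w : complete_graph n, adj v w ->
     ~ isomorphic (Gamma (complete_graph n)) (GammaTilde v w))
  /\ (1 <= n -> forall v w : complete_graph (2 * n + 1), adj v w ->
     ~ WL_distinguished n (Gamma (complete_graph (2 * n + 1)))
                          (GammaTilde v w))
  /\ (4 <= n -> forall v w : complete_graph n, adj v w ->
     seurat_forall_wins 2 (Gamma (complete_graph n)) (GammaTilde v w)).
Proof.
have irr m : irreflexive (@adj (complete_graph m)).
  by move=> x; apply: negbTE; rewrite negbK.
split=> [_ v w vw|]; first exact: Gamma_not_isomorphic.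
split=> [n1 v w vw|n4 v w vw].
  apply: Gamma_not_WL_distinguished vw.
  (* The bound n + 2 <= 2n + 1 amounts to 1 <= n. *)
  by rewrite addn1 ltnS mul2n -addnn -addn1 leq_add2l.
by apply: Gamma_seurat_forall_wins => //; rewrite card_ord.
Qed.
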